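(* With $i=\sqrt{-1}$, make the linear change of variables of $\mathbb C^8$ $$\begin{aligned}z_0&=x_0+x_2-x_4-x_6,& z_1&=x_1+x_3-x_5-x_7,\\ z_2&=x_0-i\,x_2+x_4-i\,x_6,& z_3&=x_1-i\,x_3+x_5-i\,x_7,\\ z_4&=x_0-x_2-x_4+x_6,& z_5&=x_1-x_3-x_5+x_7,\\ z_6&=x_0+i\,x_2+x_4+i\,x_6,& z_7&=x_1+i\,x_3+x_5+i\,x_7.\end{aligned}$$ Then the four generators of the ideal $I_B=\langle x_0^2+x_4^2+2x_2x_6,\ x_1^2+x_5^2+2x_3x_7,\ x_2^2+x_6^2+2x_0x_4,\ x_3^2+x_7^2+2x_1x_5\rangle$ are expressed by $$\begin{aligned}x_0^2+x_4^2+2x_2x_6&=\tfrac12(z_2z_6+z_0z_4),& x_1^2+x_5^2+2x_3x_7&=\tfrac12(z_3z_7+z_1z_5),\\ x_2^2+x_6^2+2x_0x_4&=\tfrac12(z_2z_6-z_0z_4),& x_3^2+x_7^2+2x_1x_5&=\tfrac12(z_3z_7-z_1z_5).\end{aligned}$$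
   Context: $x_0,\dots,x_7$ are coordinates on $\mathbb C^8$ (homogeneous coordinates of $\mathbb P^7$). The ideal $I_B$ is generated by the values, up to a factor $2$, at $w=(1,0,1)$ of the quadrics $f_1=\frac{w_0}{2}(x_0^2+x_4^2)+w_1(x_1x_7+x_3x_5)+w_2x_2x_6$, $f_2=\frac{w_0}{2}(x_1^2+x_5^2)+w_1(x_2x_0+x_4x_6)+w_2x_3x_7$, $f_3=\frac{w_0}{2}(x_2^2+x_6^2)+w_1(x_3x_1+x_5x_7)+w_2x_4x_0$, $f_4=\frac{w_0}{2}(x_3^2+x_7^2)+w_1(x_4x_2+x_6x_0)+w_2x_5x_1$. *)

(* Defs.v *)
From HB Require Import structures.
From mathcomp Require Import all_boot all_order all_algebra.
From mathcomp Require Import reals.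
From mathcomp.real_closed Require Export complex.
From mathcomp.multinomials Require Export mpoly.

Set Implicit Arguments.
Unset Strict Implicit.
Unset Printing Implicit Defensive.

Import GRing.Theory Num.Theory.
Local Open Scope ring_scope.

Section Coordinates.

Variables (K : fieldType) (n : nat).

(* The matrix of coefficients is square, so it is invertible exactly when the
   z_j can replace the x_k as linear coordinates on K^n. *)
Definition linear_change (z : n.-tuple {mpoly K[n]}) : Prop :=
  (forall j, tnth z j \is 1.-homog) /\
  \matrix_(j < n, k < n) ((tnth z j)@_(U_(k)%MM)) \in unitmx.

Definition ideal_gen m (g : m.-tuple {mpoly K[n]}) (p : {mpoly K[n]}) : Prop :=
  exists c : 'I_m -> {mpoly K[n]}, p = \sum_(k < m) c k * tnth g k.

End Coordinates.

(* Numerals in 'I_8 are residues mod 8; the indices used are 0, ..., 7. *)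
Definition xvar (K : fieldType) (k : 'I_8) : {mpoly K[8]} := 'X_k.

(* The values at a point w of the quadrics f_1, ..., f_4, in this order. *)
Definition quadrics (K : fieldType) (w : 3.-tuple K) : 4.-tuple {mpoly K[8]} :=
  let x := @xvar K in
  let w0 := w`_0 in let w1 := w`_1 in let w2 := w`_2 in
  [tuple
    (w0 / 2) *: (x 0 ^+ 2 + x 4 ^+ 2) + w1 *: (x 1 * x 7 + x 3 * x 5)
      + w2 *: (x 2 * x 6);
    (w0 / 2) *: (x 1 ^+ 2 + x 5 ^+ 2) + w1 *: (x 2 * x 0 + x 4 * x 6)
      + w2 *: (x 3 * x 7);
    (w0 / 2) *: (x 2 ^+ 2 + x 6 ^+ 2) + w1 *: (x 3 * x 1 + x 5 * x 7)
      + w2 *: (x 4 * x 0);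
    (w0 / 2) *: (x 3 ^+ 2 + x 7 ^+ 2) + w1 *: (x 4 * x 2 + x 6 * x 0)
      + w2 *: (x 5 * x 1)].

Definition quadrics_B (K : fieldType) : 4.-tuple {mpoly K[8]} :=
  quadrics [tuple 1; 0; 1].

Definition I_B (K : fieldType) : {mpoly K[8]} -> Prop :=
  ideal_gen (quadrics_B K).

(* Main.v *)
Require Import Defs.
From mathcomp Require Import all_boot all_order all_algebra.
From mathcomp Require Import reals.
From mathcomp Require Import ring.
Import GRing.Theory Num.Theory.
Local Open Scope ring_scope.

(** The change of variables does not mix the even-indexed coordinates with the
    odd-indexed ones, and it acts on $(a, b, c, d) = (x_0, x_2, x_4, x_6)$ and
    on $(x_1, x_3, x_5, x_7)$ by the same four forms
    $u = (a - c) + (b - d)$, $v = (a + c) - i(b + d)$,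
    $w = (a - c) - (b - d)$, $t = (a + c) + i(b + d)$.
    Hence $vt = (a + c)^2 + (b + d)^2$ and $uw = (a - c)^2 - (b - d)^2$: the
    half-sum of these products keeps $a^2 + c^2$ and $2bd$, and the
    half-difference keeps $b^2 + d^2$ and $2ac$. These are
    [sum_of_products] and [difference_of_products], used once for each parity.

    The $4 \times 4$ block of coefficients is a complex Hadamard matrix: its
    entries are fourth roots of unity and its rows are orthogonal for the
    Hermitian product. Its inverse is thus a quarter of its conjugate
    transpose, which gives the formulas [block_inverse_a], ...,
    [block_inverse_d]. They put every $x_k$ in the span of the $z_j$, and
    [linear_change_of_span] turns this into invertibility.

    Finally, $f_k$ at $w = (1, 0, 1)$ is half of the $k$-th generator, and
    rescaling generators by a unit does not change the ideal. *)

(** * Linear changes of coordinates and ideals *)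

(** The coefficients of the 'X_k on the z_j form a left inverse of the matrix
    of coefficients of the z_j; a one-sided inverse of a square matrix is an
    inverse, so no determinant has to be computed. *)
Lemma linear_change_of_span (K : fieldType) (n : nat)
    (z : n.-tuple {mpoly K[n]}) :
  (forall j, tnth z j \is 1.-homog) ->
  (forall k : 'I_n, exists d : 'I_n -> K,
     'X_k = \sum_(j < n) d j *: tnth z j) ->
  linear_change z.
Proof.
move=> homz /fin_all_exists[d xE]; split=> //.
suff /mulmx1_unit[] : (\matrix_(k < n, j < n) d k j) *m
  \matrix_(j < n, l < n) (tnth z j)@_(U_(l)%MM) = 1%:M by [].
apply/matrixP => k l; rewrite !mxE.
have -> : (k == l)%:R = ('X_k : {mpoly K[n]})@_U_(l).
  by rewrite mcoeffX eq_mnm1.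
rewrite xE raddf_sum; apply: eq_bigr => j _.
by rewrite !mxE; exact/esym/mcoeffZ.
Qed.

Lemma ideal_gen_scale (K : fieldType) (n m : nat) (a : K)
    (g h : m.-tuple {mpoly K[n]}) (p : {mpoly K[n]}) :
  (forall k, tnth g k = a *: tnth h k) -> ideal_gen g p -> ideal_gen h p.
Proof.
move=> gE [c ->]; exists (fun k => a *: c k); apply: eq_bigr => k _.
by rewrite gE -scalerAr scalerAl.
Qed.

Lemma xvar_homog (K : fieldType) (k : 'I_8) : xvar K k \is 1.-homog.
Proof. by rewrite dhomogX; exact/eqP/mdeg1. Qed.

(** Case analysis with ring numerals, the form in which indices occur in the
    quadrics, rather than with explicit ordinals. *)
Lemma ord8P (P : 'I_8 -> Prop) :
  P 0 -> P 1 -> P 2 -> P 3 -> P 4 -> P 5 -> P 6 -> P 7 -> forall k, P k.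
Proof.
move=> P0 P1 P2 P3 P4 P5 P6 P7.
case=> -[|[|[|[|[|[|[|[|//]]]]]]]] lt_k.
- by rewrite (_ : Ordinal lt_k = 0) //; apply: val_inj.
- by rewrite (_ : Ordinal lt_k = 1) //; apply: val_inj.
- by rewrite (_ : Ordinal lt_k = 2) //; apply: val_inj.
- by rewrite (_ : Ordinal lt_k = 3) //; apply: val_inj.
- by rewrite (_ : Ordinal lt_k = 4) //; apply: val_inj.
- by rewrite (_ : Ordinal lt_k = 5) //; apply: val_inj.
- by rewrite (_ : Ordinal lt_k = 6) //; apply: val_inj.
- by rewrite (_ : Ordinal lt_k = 7) //; apply: val_inj.
Qed.

(** Each x_k involves only the z_j with j of the parity of k, so its coefficient
    row is four coefficients padded with zeros. *)
Lemma span_even (K : fieldType) (V : lmodType K)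
    (z0 z1 z2 z3 z4 z5 z6 z7 p : V) (e0 e2 e4 e6 : K) :
  p = e0 *: z0 + (e2 *: z2 + (e4 *: z4 + e6 *: z6)) ->
  exists e : 'I_8 -> K,
    p = \sum_(j < 8) e j *: tnth [tuple z0; z1; z2; z3; z4; z5; z6; z7] j.
Proof.
move=> ->; exists (fun j => [:: e0; 0; e2; 0; e4; 0; e6; 0]`_j).
by rewrite !big_ord_recl big_ord0 !(tnth_nth 0) /= !scale0r !(add0r, addr0).
Qed.

Lemma span_odd (K : fieldType) (V : lmodType K)
    (z0 z1 z2 z3 z4 z5 z6 z7 p : V) (e1 e3 e5 e7 : K) :
  p = e1 *: z1 + (e3 *: z3 + (e5 *: z5 + e7 *: z7)) ->
  exists e : 'I_8 -> K,
    p = \sum_(j < 8) e j *: tnth [tuple z0; z1; z2; z3; z4; z5; z6; z7] j.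
Proof.
move=> ->; exists (fun j => [:: 0; e1; 0; e3; 0; e5; 0; e7]`_j).
by rewrite !big_ord_recl big_ord0 !(tnth_nth 0) /= !scale0r !(add0r, addr0).
Qed.

(** * One block of the change of variables *)

(** All four quadrics have this shape; $e$ stands for the middle term, which
    vanishes at $w = (1, 0, 1)$. *)
Lemma twice_quadric_at_B (K : fieldType) (A : comAlgType K) (a b c d e : A) :
  2 != 0 :> K ->
  a ^+ 2 + c ^+ 2 + 2 * b * d =
  2 *: ((1 / 2) *: (a ^+ 2 + c ^+ 2) + 0 *: e + 1 *: (b * d)).
Proof.
move=> two_neq0; rewrite scale0r addr0 scale1r div1r scalerDr scalerA.
by rewrite mulfV // scale1r scaler_nat -[b * d *+ 2]mulr_natl mulrA.
Qed.

Section ComplexHadamardBlock.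

Variables (K : fieldType) (A : comAlgType K) (i : K).
Hypotheses (ii : i ^+ 2 = -1) (two_neq0 : 2 != 0 :> K).
Variables a b c d : A.

Let u := a + b - c - d.
Let v := a - i *: b + c - i *: d.
Let w := a - b - c + d.
Let t := a + i *: b + c + i *: d.

Let four_neq0 : 4 != 0 :> K.
Proof. by rewrite (natrM _ 2 2) mulf_neq0. Qed.

Let eq_scaleV (n : nat) (p q : A) :
  n%:R != 0 :> K -> n%:R * p = q -> p = (n%:R^-1 : K) *: q.
Proof.
by move=> n0 <-; rewrite -scaler_nat -scalerAl mul1r scalerA mulVf // scale1r.
Qed.

(** The image of $i$ in $A$ is replaced by an anonymous square root $j$ of
    $-1$, so that the identities below become ring identities modulo
    $j^2 = -1$. *)
Let scale_i : exists2 j : A, j * j = -1 & forall x, i *: x = j * x.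
Proof.
exists i%:A => [|x]; last by rewrite mulr_algl.
by rewrite -scalerAl mul1r scalerA -expr2 ii scaleN1r.
Qed.

Lemma sum_of_products : a ^+ 2 + c ^+ 2 + 2 * b * d = 2^-1 *: (v * t + u * w).
Proof.
have [j jj iE] := scale_i.
by apply: (eq_scaleV 2%N _ _ two_neq0); rewrite /u /v /w /t !iE; ring: jj.
Qed.

Lemma difference_of_products :
  b ^+ 2 + d ^+ 2 + 2 * a * c = 2^-1 *: (v * t - u * w).
Proof.
have [j jj iE] := scale_i.
by apply: (eq_scaleV 2%N _ _ two_neq0); rewrite /u /v /w /t !iE; ring: jj.
Qed.

(** By orthogonality of the rows of the block, the coefficients in the next four
    identities are a quarter of the inverses of the entries of its columns; for
    roots of unity, inverses and conjugates agree. *)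
Lemma block_inverse_a :
  a = 4^-1 *: u + (4^-1 *: v + (4^-1 *: w + 4^-1 *: t)).
Proof.
rewrite -!scalerDr; apply: (eq_scaleV 4%N _ _ four_neq0).
by have [j jj iE] := scale_i; rewrite /u /v /w /t !iE; ring: jj.
Qed.

Lemma block_inverse_b :
  b = 4^-1 *: u + ((4^-1 * i) *: v + ((4^-1 * -1) *: w + (4^-1 * - i) *: t)).
Proof.
rewrite -!scalerA -!scalerDr; apply: (eq_scaleV 4%N _ _ four_neq0).
rewrite scaleN1r scaleNr.
by have [j jj iE] := scale_i; rewrite /u /v /w /t !iE; ring: jj.
Qed.

Lemma block_inverse_c :
  c = (4^-1 * -1) *: u + (4^-1 *: v + ((4^-1 * -1) *: w + 4^-1 *: t)).
Proof.
rewrite -!scalerA -!scalerDr; apply: (eq_scaleV 4%N _ _ four_neq0).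
rewrite !scaleN1r.
by have [j jj iE] := scale_i; rewrite /u /v /w /t !iE; ring: jj.
Qed.

Lemma block_inverse_d :
  d = (4^-1 * -1) *: u + ((4^-1 * i) *: v + (4^-1 *: w + (4^-1 * - i) *: t)).
Proof.
rewrite -!scalerA -!scalerDr; apply: (eq_scaleV 4%N _ _ four_neq0).
rewrite scaleN1r scaleNr.
by have [j jj iE] := scale_i; rewrite /u /v /w /t !iE; ring: jj.
Qed.

End ComplexHadamardBlock.

Theorem proposition8p6 (R : realType) :
  let x := @xvar R[i] in
  let z0 := x 0 + x 2 - x 4 - x 6 in
  let z1 := x 1 + x 3 - x 5 - x 7 in
  let z2 := x 0 - 'i *: x 2 + x 4 - 'i *: x 6 in
  let z3 := x 1 - 'i *: x 3 + x 5 - 'i *: x 7 in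
  let z4 := x 0 - x 2 - x 4 + x 6 in
  let z5 := x 1 - x 3 - x 5 + x 7 in
  let z6 := x 0 + 'i *: x 2 + x 4 + 'i *: x 6 in
  let z7 := x 1 + 'i *: x 3 + x 5 + 'i *: x 7 in
  let g1 := x 0 ^+ 2 + x 4 ^+ 2 + 2 * x 2 * x 6 in
  let g2 := x 1 ^+ 2 + x 5 ^+ 2 + 2 * x 3 * x 7 in
  let g3 := x 2 ^+ 2 + x 6 ^+ 2 + 2 * x 0 * x 4 in
  let g4 := x 3 ^+ 2 + x 7 ^+ 2 + 2 * x 1 * x 5 in
  linear_change [tuple z0; z1; z2; z3; z4; z5; z6; z7] /\
  (forall k, tnth [tuple g1; g2; g3; g4] k = 2 *: tnth (quadrics_B R[i]) k) /\
  (forall p, I_B p <-> ideal_gen [tuple g1; g2; g3; g4] p) /\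
  g1 = 2^-1 *: (z2 * z6 + z0 * z4) /\
  g2 = 2^-1 *: (z3 * z7 + z1 * z5) /\
  g3 = 2^-1 *: (z2 * z6 - z0 * z4) /\
  g4 = 2^-1 *: (z3 * z7 - z1 * z5).
Proof.
move=> x z0 z1 z2 z3 z4 z5 z6 z7 g1 g2 g3 g4.
have ii : 'i ^+ 2 = -1 :> R[i] by exact: sqrCi.
have two_neq0 : 2 != 0 :> R[i] by rewrite pnatr_eq0.
have gE k : tnth [tuple g1; g2; g3; g4] k = 2 *: tnth (quadrics_B R[i]) k.
  rewrite !(tnth_nth 0) /quadrics_B /quadrics -/x.
  case: k => -[|[|[|[|//]]]] lt_k /=.
  - exact: twice_quadric_at_B.
  - exact: twice_quadric_at_B.
  (* In $f_3$ and $f_4$ the factors of the last product come in the other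
     order. *)
  - by rewrite /g3 mulrAC; exact: twice_quadric_at_B.
  - by rewrite /g4 mulrAC; exact: twice_quadric_at_B.
split.
  apply: linear_change_of_span.
    have homx k : x k \is 1.-homog by exact: xvar_homog.
    apply: ord8P; rewrite (tnth_nth 0) /=;
      by rewrite ?(rpredD, rpredB, rpredN, rpredZ, homx).
  apply: ord8P.
  - by apply: span_even; exact: block_inverse_a.
  - by apply: span_odd; exact: block_inverse_a.
  - by apply: span_even; exact: block_inverse_b.
  - by apply: span_odd; exact: block_inverse_b.
  - by apply: span_even; exact: block_inverse_c.
  - by apply: span_odd; exact: block_inverse_c.
  - by apply: span_even; exact: block_inverse_d.
  - by apply: span_odd; exact: block_inverse_d.
split; first exact: gE.
split.
  move=> p; split; last exact: ideal_gen_scale gE.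
  apply: (@ideal_gen_scale _ _ _ 2^-1) => k.
  by rewrite gE scalerA mulVf // scale1r.
split; first exact: sum_of_products.
split; first exact: sum_of_products.
by split; exact: difference_of_products.
Qed.
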